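(* Let $\vec a(s_a)$ and $\vec b(s_b)$ be two Cartan framed null curves in Minkowski 3-space $E_1^3$, with frames $\{\vec\alpha_a,\vec\gamma_a,\vec\beta_a\}$, $\{\vec\alpha_b,\vec\gamma_b,\vec\beta_b\}$ and torsions $\tau_a,\tau_b$. Then $\vec a(s_a)$ and $\vec b(s_b)$ are null similar curves with variable transformation if and only if the vectors $\vec\gamma$ of the two curves are the same, i.e. $$\vec\gamma_a(s_a)=\vec\gamma_b(s_b),$$ under the particular variable transformation $$\lambda_b^a=\frac{\tau_b}{\tau_a}$$ of the arc lengths.
   Context: $E_1^3$ is $\mathbb R^3$ with the Lorentz metric $\langle\cdot,\cdot\rangle=-dx_1^2+dx_2^2+dx_3^2$ and vector product $\vec x\times\vec y=(x_2y_3-x_3y_2,\;x_1y_3-x_3y_1,\;x_2y_1-x_1y_2)$. A vector $\vec v\neq0$ is null if $\langle\vec v,\vec v\rangle=0$; a curve is null if all its velocity vectors are null. A Cartan framed null curve (null Frenet curve) $\vec a=\vec a(s)$ is a curve admitting a frame field $\{\vec\alpha,\vec\gamma,\vec\beta\}$ and functions $\kappa$ (curvature), $\tau$ (torsion) with $\vec\alpha=d\vec a/ds$, $\langle\vec\alpha,\vec\alpha\rangle=\langle\vec\gamma,\vec\gamma\rangle=0$, $\langle\vec\beta,\vec\beta\rangle=\langle\vec\alpha,\vec\gamma\rangle=1$, $\vec\beta=\vec\alpha\times\vec\gamma$, and $\vec\alpha'=\kappa\vec\beta$, $\vec\gamma'=\tau\vec\beta$, $\vec\beta'=-\tau\vec\alpha-\kappa\vec\gamma$,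 where $'=d/ds$. The parameter $s$ is called the arc length parameter. Subscripts $a$, $b$ indicate the data of $\vec a(s_a)$, $\vec b(s_b)$. Null similar curves with variable transformation $\lambda_b^a$: $\vec a(s_a)$ and $\vec b(s_b)$ are so called if there exists a variable transformation $s_a=\int\lambda_b^a(s_b)\,ds_b$ of the arc lengths such that $\vec\alpha_a(s_a)=\vec\alpha_b(s_b)$ for all corresponding values of the parameters.
   Formalization: Added: the curvature of b vanishes identically on no subinterval (two null lines with the same α are null similar but may have disjoint sets of γ, so the claim fails), and τ_a is nowhere zero so that τ_b/τ_a is defined. *)

(* Defs.v *)
From HB Require Import structures.
From mathcomp Require Import all_boot all_order all_algebra.
From mathcomp Require Import all_classical all_reals all_analysis.
Set Implicit Arguments.
Unset Strict Implicit.
Unset Printing Implicit Defensive.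
Import Order.TTheory GRing.Theory Num.Theory.
Import numFieldNormedType.Exports.
Local Open Scope classical_set_scope.
Local Open Scope ring_scope.

(* Coordinates x_1, x_2, x_3 of E_1^3 are indexed by x1, x2, x3 : 'I_3. *)
Definition x1 : 'I_3 := @Ordinal 3 0 isT.
Definition x2 : 'I_3 := @Ordinal 3 1 isT.
Definition x3 : 'I_3 := @Ordinal 3 2 isT.

Definition lorentz (R : realType) (x y : 'rV[R]_3) : R :=
  - (x 0 x1 * y 0 x1) + x 0 x2 * y 0 x2 + x 0 x3 * y 0 x3.

(* The Lorentzian vector product: the first coordinate and the sign pattern
   differ from those of the Euclidean cross product. *)
Definition lorentz_cross (R : realType) (x y : 'rV[R]_3) : 'rV[R]_3 :=
  \row_(j < 3)
    if j == x1 then x 0 x2 * y 0 x3 - x 0 x3 * y 0 x2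
    else if j == x2 then x 0 x1 * y 0 x3 - x 0 x3 * y 0 x1
    else x 0 x2 * y 0 x1 - x 0 x1 * y 0 x2.

Definition null_vector (R : realType) (v : 'rV[R]_3) : Prop :=
  v != 0 /\ lorentz v v = 0.

(* A null Frenet curve on an open interval, together with its frame and
   curvatures. All functions are total on R and are constrained only on the
   domain; differentiability is required exactly as far as the Frenet formulas
   ask for it, which covers the smooth case. *)
Record null_frenet_curve (R : realType) := NullFrenetCurve {
  dom : set R;
  curve : R -> 'rV[R]_3;
  alpha : R -> 'rV[R]_3;
  gamma : R -> 'rV[R]_3;
  beta : R -> 'rV[R]_3;
  kappa : R -> R;
  tau : R -> R;
  dom_open : open dom;
  dom_interval : is_interval dom;
  dom_nonempty : dom !=set0;
  curve_deriv : forall s, dom s -> is_derive s 1 curve (alpha s);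
  alpha_null : forall s, dom s -> null_vector (alpha s);
  gamma_gamma : forall s, dom s -> lorentz (gamma s) (gamma s) = 0;
  beta_beta : forall s, dom s -> lorentz (beta s) (beta s) = 1;
  alpha_gamma : forall s, dom s -> lorentz (alpha s) (gamma s) = 1;
  beta_cross : forall s, dom s -> beta s = lorentz_cross (alpha s) (gamma s);
  alpha_deriv : forall s, dom s ->
    is_derive s 1 alpha (kappa s *: beta s);
  gamma_deriv : forall s, dom s ->
    is_derive s 1 gamma (tau s *: beta s);
  beta_deriv : forall s, dom s ->
    is_derive s 1 beta (- (tau s *: alpha s) - kappa s *: gamma s)
}.

(* phi expresses s_a = phi s_b as an antiderivative of the continuous function
   lambda; as a change of parameter it is regular (lambda does not vanish) and
   puts the two parameter intervals in one-to-one correspondence. *)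
Definition variable_transformation (R : realType) (a b : null_frenet_curve R)
    (phi lambda : R -> R) : Prop :=
  [/\ set_bij (dom b) (dom a) phi,
      {within dom b, continuous lambda},
      forall s, dom b s -> is_derive s 1 phi (lambda s)
    & forall s, dom b s -> lambda s != 0].

Definition null_similar (R : realType) (a b : null_frenet_curve R) : Prop :=
  exists phi lambda : R -> R,
    variable_transformation a b phi lambda /\
    forall s, dom b s -> alpha a (phi s) = alpha b s.

(* The curvature vanishes identically on no subinterval, i.e. no arc of the
   curve is a piece of a null line (along which the tangent, being constant,
   does not determine the rest of the frame). *)
Definition no_null_line_segment (R : realType) (c : null_frenet_curve R) :
    Prop :=
  forall u v : R, u < v -> (forall s, u < s < v -> dom c s) ->
    exists2 s, u < s < v & kappa c s != 0.

(* Main.v *)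
(* For null vectors normalised by [<alpha, gamma> = 1], either of alpha and
   gamma is determined by the other together with the line spanned by
   [beta = alpha x gamma]. Differentiating [alpha_a o phi = alpha_b] shows that
   the lines of the two betas agree wherever [kappa_b] does not vanish, hence
   so do the gammas there, and everywhere by density; differentiating once more
   gives [lambda * tau_a = tau_b]. Conversely, differentiating
   [gamma_a o phi = gamma_b] shows that the betas agree, hence the alphas. *)

Require Import Defs.
From HB Require Import structures.
From mathcomp Require Import all_boot all_order all_algebra.
From mathcomp Require Import all_classical all_reals all_analysis.
From mathcomp Require Import ring lra.
Import Order.TTheory GRing.Theory Num.Theory.
Import numFieldNormedType.Exports.
Local Open Scope classical_set_scope.
Local Open Scope ring_scope.

Lemma lorentz_crossC (R : realType) (x y : 'rV[R]_3) :
  lorentz_cross y x = - lorentz_cross x y.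
Proof. by apply/rowP => j; rewrite !mxE; do 2?case: ifP => _; ring. Qed.

(* [w x (u - c v) = 0] makes [u - c v] a multiple [d w] of [w]; pairing with
   [w] gives [c = 1], and then [<u, u> = <v, v> + 2 d] gives [d = 0]. *)
Lemma null_cross_inj {R : realType} {u v w : 'rV[R]_3} {c : R} :
  lorentz w w = 0 -> lorentz u u = 0 -> lorentz v v = 0 ->
  lorentz w u = 1 -> lorentz w v = 1 ->
  lorentz_cross w u = c *: lorentz_cross w v -> u = v.
Proof.
rewrite /lorentz => ww uu vv wu wv /rowP cuv.
have := cuv x1; have := cuv x2; have := cuv x3; rewrite !mxE /= => {cuv}.
have rowE (x y : 'rV[R]_3) :
    x 0 x1 = y 0 x1 -> x 0 x2 = y 0 x2 -> x 0 x3 = y 0 x3 -> x = y.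
  move=> e1 e2 e3; apply/rowP => -[[|[|[|//]]] lti3].
  - by rewrite (_ : Ordinal lti3 = x1) //; apply: val_inj.
  - by rewrite (_ : Ordinal lti3 = x2) //; apply: val_inj.
  - by rewrite (_ : Ordinal lti3 = x3) //; apply: val_inj.
move: ww uu vv wu wv (rowE u v) => {rowE}.
move: (w 0 x1) (w 0 x2) (w 0 x3) (u 0 x1) (u 0 x2) (u 0 x3).
move: (v 0 x1) (v 0 x2) (v 0 x3).
move=> v1 v2 v3 w1 w2 w3 u1 u2 u3 ww uu vv wu wv uv e3 e2 e1.
(* If [w1 = 0], nullity leaves [w2 ^+ 2 + w3 ^+ 2 = 0], so [w = 0], against [<w, u> = 1]. *)
have w1_neq0 : w1 != 0.
  apply/eqP => w10; have w2w3 : w2 ^+ 2 + w3 ^+ 2 = 0.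
    by rewrite -ww w10; ring.
  have /andP[] : (w2 ^+ 2 == 0) && (w3 ^+ 2 == 0).
    by rewrite -paddr_eq0 ?sqr_ge0 // w2w3.
  rewrite !sqrf_eq0 => /eqP w20 /eqP w30.
  move: wu; rewrite w10 w20 w30 !mul0r oppr0 !addr0 => /esym/eqP.
  by rewrite oner_eq0.
(* The first coordinate dictates [d]; the cross-product equations [e3] and [e2], cancelled by [w1],
   carry it over to the second and third. *)
pose d := (u1 - c * v1) / w1.
have dw1 : d * w1 = u1 - c * v1 by rewrite /d divfK.
have u1E : u1 = c * v1 + d * w1 by rewrite dw1 addrC subrK.
have u2E : u2 = c * v2 + d * w2.
  apply: (mulfI w1_neq0).
  have -> : w1 * (c * v2 + d * w2) = c * (w1 * v2) + d * w1 * w2 by ring.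
  by rewrite dw1; lra.
have u3E : u3 = c * v3 + d * w3.
  apply: (mulfI w1_neq0).
  have -> : w1 * (c * v3 + d * w3) = c * (w1 * v3) + d * w1 * w3 by ring.
  by rewrite dw1; lra.
have c1 : c = 1.
  have : - (w1 * u1) + w2 * u2 + w3 * u3 =
    c * (- (w1 * v1) + w2 * v2 + w3 * v3)
    + d * (- (w1 * w1) + w2 * w2 + w3 * w3) by rewrite u1E u2E u3E; ring.
  by rewrite wu wv ww; lra.
have d0 : d = 0.
  have : - (u1 * u1) + u2 * u2 + u3 * u3 =
    (- (v1 * v1) + v2 * v2 + v3 * v3)
    + 2 * d * (- (w1 * v1) + w2 * v2 + w3 * v3)
    + d ^+ 2 * (- (w1 * w1) + w2 * w2 + w3 * w3)
    by rewrite u1E u2E u3E c1; ring.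
  by rewrite uu vv wv ww; lra.
by apply: uv; rewrite ?u1E ?u2E ?u3E c1 d0; ring.
Qed.

(** In one variable derivability is differentiability, so differentials compose; that of [g] sends 1
    to [l], which linearity pulls out. *)
Lemma is_derive_reparam {R : realType} {V : normedModType R} {f : R -> V}
    {g : R -> R} {s l : R} {df : V} :
  is_derive (g s) 1 f df -> is_derive s 1 g l ->
  is_derive s 1 (f \o g) (l *: df).
Proof.
move=> [fd <-] [gd <-].
have /derivable1_diffP fdiff := fd; have /derivable1_diffP gdiff := gd.
have fgdiff := differentiable_comp gdiff fdiff.
split; first exact/derivable1_diffP.
by rewrite (deriveE _ fgdiff) diff_comp//= -(deriveE _ gdiff) diff1E// derive1E.
Qed.

(** Derivatives are local. This allows differentiating identities known only on [dom b]. *)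
Lemma is_derive_unique_open {R : realType} {V : normedModType R} {D : set R}
    {f g : R -> V} {s : R} {df dg : V} :
  open D -> D s -> (forall t, D t -> f t = g t) ->
  is_derive s 1 f df -> is_derive s 1 g dg -> df = dg.
Proof.
move=> Dopen Ds fg fD gD.
have fgs : \near s, f s = g s.
  by apply: filterS (open_nbhs_nbhs (conj Dopen Ds)).
have [_ <-] := near_eq_is_derive fgs fD.
by have [_ <-] := gD.
Qed.

Lemma is_derive_continuous {R : realType} {V : normedModType R} {f : R -> V}
    {s : R} {df : V} : is_derive s 1 f df -> {for s, continuous f}.
Proof. by move=> [fd _]; apply/differentiable_continuous/derivable1_diffP. Qed.

(** Were [f - g] nonzero at [s], it would be nonzero on a ball inside [D], an interval that must
    contain a point of equality. *)
Lemma continuous_eq_dense {R : realType} {V : normedModType R} {D : set R}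
    {f g : R -> V} :
  open D ->
  (forall s, D s -> {for s, continuous f}) ->
  (forall s, D s -> {for s, continuous g}) ->
  (forall u v : R, u < v -> (forall s, u < s < v -> D s) ->
     exists2 s, u < s < v & f s = g s) ->
  forall s, D s -> f s = g s.
Proof.
move=> Dopen fc gc fg s Ds; apply/eqP; rewrite -subr_eq0; apply/negP => /negP.
have fgc : (fun t => f t - g t) @ s --> f s - g s.
  by apply: cvgB; [exact: fc|exact: gc].
move=> /(cvgr_neq0 _ fgc) fg_neq0.
have : nbhs s (D `&` [set t | f t - g t != 0]).
  exact: filterI (open_nbhs_nbhs (conj Dopen Ds)) fg_neq0.
move=> /nbhs_ballP[e /= e0 De].
have ball_itv t : s - e < t < s + e -> ball s e t.
  by move=> tse; rewrite /ball/= distrC ltr_distl.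
have [||t /ball_itv /De[_ /=]] := fg (s - e) (s + e).
- by rewrite ltrD2l gt0_cp.
- by move=> t /ball_itv /De[].
- by rewrite subr_eq0 => /eqP.
Qed.

Lemma beta_neq0 {R : realType} {c : null_frenet_curve R} {s : R} :
  dom c s -> beta c s != 0.
Proof.
move=> cs; apply/eqP => b0; have := beta_beta cs.
by rewrite b0 /lorentz !mxE !mulr0 oppr0 !addr0 => /esym/eqP; rewrite oner_eq0.
Qed.

Theorem theorem3p3 (R : realType) (a b : null_frenet_curve R)
    (tau_a_neq0 : forall s, dom a s -> tau a s != 0)
    (kappa_b_neq0 : no_null_line_segment b) :
  null_similar a b <->
  exists phi lambda : R -> R,
    [/\ variable_transformation a b phi lambda,
        forall s, dom b s -> lambda s = tau b s / tau a (phi s)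
      & forall s, dom b s -> gamma a (phi s) = gamma b s].
Proof.
split=> [[phi [lambda [phiV alphaE]]]|[phi [lambda [phiV lambdaE gammaE]]]];
  exists phi, lambda; have [[phi_ab _ _] _ phiD lambda_neq0] := phiV.
- have gammaD s (bs : dom b s) :=
    is_derive_reparam (gamma_deriv (phi_ab s bs)) (phiD s bs).
  have gammaE : forall s, dom b s -> gamma a (phi s) = gamma b s.
    apply: (@continuous_eq_dense _ _ _ (gamma a \o phi) _ (@dom_open _ b)).
    + by move=> s /gammaD /is_derive_continuous.
    + by move=> s /gamma_deriv /is_derive_continuous.
    move=> u v uv uvb; have [s suv kappa_neq0] := kappa_b_neq0 u v uv uvb.
    exists s => //; have bs := uvb s suv; have as_ := phi_ab s bs.
    have := is_derive_unique_open (@dom_open _ b) bs alphaE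
      (is_derive_reparam (alpha_deriv as_) (phiD s bs)) (alpha_deriv bs).
    (* Dividing by [kappa b s] writes [beta b s] as a multiple of [beta a (phi s)], both being cross
       products with the common alpha. *)
    move=> /(congr1 (fun x => (kappa b s)^-1 *: x)).
    rewrite !scalerA mulVf// scale1r !beta_cross// alphaE// => crossE.
    have [_ ww] := alpha_null bs.
    have wa : lorentz (alpha b s) (gamma a (phi s)) = 1.
      by rewrite -alphaE// alpha_gamma.
    apply/esym/(null_cross_inj ww _ _ _ wa (esym crossE)) => //;
      by rewrite ?gamma_gamma ?alpha_gamma.
  split=> // s bs; have as_ := phi_ab s bs.
  have := is_derive_unique_open (@dom_open _ b) bs gammaE (gammaD s bs)
    (gamma_deriv bs).
  (* Equal alphas and gammas give equal betas, so the nonzero [beta b s] cancels. *)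
  rewrite (beta_cross as_) alphaE// gammaE// -beta_cross// scalerA.
  move=> /eqP; rewrite -subr_eq0 -scalerBl scaler_eq0 (negbTE (beta_neq0 bs)).
  by rewrite orbF subr_eq0 => /eqP <-; rewrite mulfK// tau_a_neq0.
- split=> // s bs; have as_ := phi_ab s bs.
  (* Regularity of [phi] keeps the quotient [tau_b / tau_a] nonzero; [tau b s] can then be cancelled
     below. *)
  have tau_neq0 : tau b s != 0.
    by apply: contraNneq (lambda_neq0 s bs) => t0; rewrite lambdaE// t0 mul0r.
  have := is_derive_unique_open (@dom_open _ b) bs gammaE
    (is_derive_reparam (gamma_deriv as_) (phiD s bs)) (gamma_deriv bs).
  rewrite scalerA lambdaE// divfK ?tau_a_neq0// => /(scalerI tau_neq0).
  (* Antisymmetry puts the common gamma first, so [null_cross_inj] applies with alpha and gamma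
     exchanged and [c = 1]. *)
  rewrite !beta_cross// => /(congr1 -%R); rewrite -!lorentz_crossC gammaE//.
  rewrite -[RHS]scale1r => crossE.
  have lorentzC (x y : 'rV[R]_3) : lorentz x y = lorentz y x.
    by rewrite /lorentz; ring.
  have wa : lorentz (gamma b s) (alpha a (phi s)) = 1.
    by rewrite -gammaE// lorentzC alpha_gamma.
  have wb : lorentz (gamma b s) (alpha b s) = 1 by rewrite lorentzC alpha_gamma.
  have [_ aa] := alpha_null as_; have [_ bb] := alpha_null bs.
  exact: null_cross_inj (gamma_gamma bs) aa bb wa wb crossE.
Qed.
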